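(* Let $\alpha(n)=o(\log n)$ be a monotone non-decreasing function of $n$. There is an instance of fully dynamic load balancing (in the restricted assignment setting), with $n$ jobs for arbitrarily large $n$, such that any offline algorithm that maintains at all times a fractional schedule of the active jobs with makespan at most $\alpha(n)T^*$ must incur an amortized recourse of $n^{\Omega(1/\alpha(n))}$.
   Context: Fully dynamic load balancing with recourse (restricted assignment): there is a set $M$ of machines and a set $J$ of $n$ jobs; job $j$ has a size $p_j$ and a set of machines on which it may be placed, and placing it (or a fraction of it) on an allowed machine contributes $p_j$ (times the fraction) to that machine's load. Jobs arrive and depart over time, each job arriving exactly once and departing exactly once, for $2n$ events in total; it is guaranteed that at every time the active jobs admit a schedule of makespan at most a given $T^*$. A fractional schedule assigns to each active job $j$ nonnegative fractions on its allowed machines summing to $1$; its makespan is the maximum over machines of the total fractional load. Moving an $x$ fraction of a job from one machine to another incurs recourse $x$. An algorithm has amortized recourse $\beta$ if for every $t$ the total recourse during the first $t$ events is at most $\beta t$. An offline algorithm knows the entire event sequence in advance. *)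

(* Defs.v *)
From HB Require Import structures.
From mathcomp Require Import all_boot all_order all_algebra.
From mathcomp Require Import reals exp.
Set Implicit Arguments. Unset Strict Implicit. Unset Printing Implicit Defensive.
Import Order.TTheory GRing.Theory Num.Theory.
Local Open Scope ring_scope.

(* An event is (true, j) = arrival of job j, (false, j) = departure of job j. *)
Definition event (n : nat) := (bool * 'I_n)%type.

Definition valid_events (n : nat) (ev : seq (event n)) : Prop :=
  forall j : 'I_n,
    [/\ count_mem (true, j) ev = 1%N,
        count_mem (false, j) ev = 1%N &
        (index (true, j) ev < index (false, j) ev)%N].

Definition active (n : nat) (ev : seq (event n)) (t : nat) (j : 'I_n) : bool :=
  ((true, j) \in take t ev) && ((false, j) \notin take t ev).

Definition feasible_instance (R : realType) (n m : nat) (p : 'I_n -> R)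
    (allowed : 'I_n -> {set 'I_m}) (ev : seq (event n)) (Tstar : R) : Prop :=
  forall t, (t <= size ev)%N ->
    exists sigma : 'I_n -> 'I_m,
      (forall j, active ev t j -> sigma j \in allowed j) /\
      (forall i : 'I_m,
         \sum_(j < n | active ev t j && (sigma j == i)) p j <= Tstar).

Definition frac_schedule (R : realType) (n m : nat)
    (allowed : 'I_n -> {set 'I_m}) (ev : seq (event n)) (t : nat)
    (x : 'I_n -> 'I_m -> R) : Prop :=
  forall j, active ev t j ->
    [/\ forall i, 0 <= x j i,
        forall i, i \notin allowed j -> x j i = 0 &
        \sum_(i < m) x j i = 1].

Definition load (R : realType) (n m : nat) (p : 'I_n -> R)
    (ev : seq (event n)) (t : nat) (x : 'I_n -> 'I_m -> R) (i : 'I_m) : R :=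
  \sum_(j < n | active ev t j) p j * x j i.

(* Recourse of the t-th event (t >= 1): going from schedule X (t-1) to X t.
   Moving an x-fraction of a job between two machines costs x, so the
   (minimum) recourse for a job is half the L1 distance of its fraction
   vectors; only jobs active both before and after the event are counted
   (placing an arriving job / removing a departing job is free). *)
Definition step_recourse (R : realType) (n m : nat) (ev : seq (event n))
    (X : nat -> 'I_n -> 'I_m -> R) (t : nat) : R :=
  \sum_(j < n | active ev t.-1 j && active ev t j)
     ((\sum_(i < m) `|X t j i - X t.-1 j i|) / 2).

Definition total_recourse (R : realType) (n m : nat) (ev : seq (event n))
    (X : nat -> 'I_n -> 'I_m -> R) (t : nat) : R :=
  \sum_(s < t) step_recourse ev X s.+1.

(* Main.v *)
Require Import Defs.
From HB Require Import structures.
From mathcomp Require Import all_boot all_order all_algebra.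
From mathcomp Require Import reals exp.
From mathcomp Require Import zify lra.
Set Implicit Arguments. Unset Strict Implicit. Unset Printing Implicit Defensive.
Import Order.TTheory GRing.Theory Num.Theory.
Local Open Scope ring_scope.

(* Fix h > 4 alpha levels and a large radix B = 2 r; the leaves of a B-ary tree
   of depth h, read from left to right, serve as times.  At time tau the machine
   of interest is the one whose h bits are the parities of the base-B digits of
   tau.  A job (k, w) has size r^-k and is alive while the digits of tau above
   position k are those of w; it may use the two machines that agree with the
   parities of w and differ at bit k.  At each time, sending every job to the
   side not taken by the parity of digit k of tau gives load at most 1.

   On average over tau, a level whose jobs never move puts load 1/2 on the
   machine of tau, because each job is on the wrong side at digit 2i or at digit
   2i + 1; the total of h/2 exceeds alpha by a constant factor.  A level lowers
   its share only by moving its jobs in each of the r consecutive pairs of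
   children.  All levels have B^(h-1) jobs, so the recourse is at least of order
   r times the number of jobs, while n is at most (8 r)^h.  Jobs that are alone
   in the system, appended after the last leaf, bring the number of jobs to n. *)

(** * Event sequences built from lifetimes *)

Section Timeline.
Variables (n : nat) (s e : 'I_n -> nat).
Hypothesis lt_se : forall j, (s j < e j)%N.

(* Departures come before arrivals with the same time stamp, so that every
   prefix of the timeline has active jobs among those alive at some time. *)
Definition event_key (a : event n) : nat :=
  if a.1 then (s a.2).*2.+1 else (e a.2).*2.

Definition timeline : seq (event n) :=
  sort (relpre event_key leq) (enum {: bool * 'I_n}).

(** Position just after all events stamped at most [tau]: the bound [tau.*2.+1] admits exactly the
    arrivals with [s j <= tau] and the departures with [e j <= tau]. *)
Definition clock (tau : nat) : nat :=
  count (fun a => event_key a <= tau.*2.+1)%N timeline.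

Lemma key_leq_trans : transitive (relpre event_key leq).
Proof. by move=> b a c /=; apply: leq_trans. Qed.

Lemma timeline_sorted : sorted (relpre event_key leq) timeline.
Proof. by apply: sort_sorted => a b /=; apply: leq_total. Qed.

Lemma perm_timeline : perm_eq timeline (enum {: bool * 'I_n}).
Proof. by rewrite perm_sort. Qed.

Lemma mem_timeline a : a \in timeline.
Proof. by rewrite (perm_mem perm_timeline) mem_enum. Qed.

Lemma timeline_valid : valid_events timeline.
Proof.
have uT : uniq timeline by rewrite (perm_uniq perm_timeline) enum_uniq.
move=> j; rewrite !count_uniq_mem ?mem_timeline //; split=> //.
rewrite ltnNge; apply/negP => le_idx.
have /= := sorted_leq_nth key_leq_trans (fun a => leqnn (event_key a))
  (false, j) timeline_sorted.
move/(_ (index (false, j) timeline) (index (true, j) timeline)).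
rewrite !inE !index_mem !mem_timeline !nth_index ?mem_timeline //.
by move=> /(_ isT isT le_idx); rewrite /event_key /=; have := lt_se j; lia.
Qed.

Lemma take_count_sorted (c : nat) (l : seq (event n)) :
  sorted (relpre event_key leq) l ->
  take (count (fun a => event_key a <= c)%N l) l =
  [seq a <- l | (event_key a <= c)%N].
Proof.
elim: l => //= a l IHl sal; have := order_path_min key_leq_trans sal.
move=> /allP le_a; case: leqP => [_|lt_ca] /=.
  by rewrite IHl // (path_sorted sal).
have no_l : {in l, forall b, (event_key b <= c)%N = false}.
  by move=> b /le_a /=; lia.
by rewrite (eq_in_count no_l) (eq_in_filter no_l) count_pred0 filter_pred0.
Qed.

Lemma mem_take_clock tau a :
  (a \in take (clock tau) timeline) = (event_key a <= tau.*2.+1)%N.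
Proof.
by rewrite take_count_sorted ?timeline_sorted // mem_filter mem_timeline andbT.
Qed.

Lemma active_clock tau j : active timeline (clock tau) j = (s j <= tau < e j)%N.
Proof. by rewrite /active !mem_take_clock /event_key /=; lia. Qed.

Lemma active_timeline t :
  exists tau, forall j, active timeline t j -> (s j <= tau < e j)%N.
Proof.
move eq_t: (take t timeline) => l; case/lastP: l eq_t => [|l a] eq_t.
  by exists 0%N => j; rewrite /active eq_t.
have : pairwise (relpre event_key leq) (rcons l a ++ drop t timeline).
  rewrite -eq_t cat_take_drop -(sorted_pairwise key_leq_trans).
  exact: timeline_sorted.
rewrite pairwise_cat pairwise_rcons => /and3P[/allrelP le_a /andP[/allP ge_a _] _].
(* If the prefix ends with an arrival stamped [u], the time is [u]; if it ends with a departure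
   stamped [u], it is [u - 1], when the jobs departing at [u] are still alive. *)
exists (event_key a).-1./2 => j; rewrite /active eq_t => /andP[s_in e_notin].
have {s_in} le_s : (event_key (true, j) <= event_key a)%N.
  by move: s_in; rewrite mem_rcons inE => /predU1P[<-|/ge_a].
have {e_notin} ge_e : (event_key a <= event_key (false, j))%N.
  apply: (le_a a (false, j)); first by rewrite mem_rcons mem_head.
  have := mem_timeline (false, j); rewrite -[X in _ \in X](cat_take_drop t).
  by rewrite mem_cat eq_t (negPf e_notin).
by move: le_s ge_e; rewrite /event_key /=; have := lt_se j; lia.
Qed.

Lemma clock_mono tau tau' : (tau <= tau')%N -> (clock tau <= clock tau')%N.
Proof. by move=> le_tau; apply: sub_count => a /=; lia. Qed.

Lemma clock_le_size tau : (clock tau <= size timeline)%N.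
Proof. exact: count_size. Qed.

Lemma clock_gt0 tau j : (s j <= tau)%N -> (0 < clock tau)%N.
Proof.
move=> le_s; rewrite -has_count; apply/hasP; exists (true, j).
  exact: mem_timeline.
by rewrite /event_key /=; lia.
Qed.

(** A departed job has also started, so each started job accounts for at most two events. This later
    bounds the number of events by the hierarchy jobs alone, whatever the padding. *)
Lemma clock_le_card tau : (clock tau <= 2 * #|[pred j | s j <= tau]|)%N.
Proof.
rewrite /clock (permP perm_timeline) -size_filter -card_bool -cardX cardE.
apply: uniq_leq_size => [|[b j]]; first by rewrite filter_uniq ?enum_uniq.
rewrite mem_filter mem_enum andbT mem_enum !inE /event_key /=.
by case: b; have := lt_se j; lia.
Qed.

(** * Recourse of a single job *)

Section Recourse.
Variables (R : realType) (m : nat) (allowed : 'I_n -> {set 'I_m}).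
Variable X : nat -> 'I_n -> 'I_m -> R.
Hypothesis schedX : forall t, (t <= size timeline)%N ->
  frac_schedule allowed timeline t (X t).

Definition job_recourse (j : 'I_n) (tau : nat) : R :=
  \sum_(t < clock tau | active timeline t j && active timeline t.+1 j)
     ((\sum_(i < m) `|X t.+1 j i - X t j i|) / 2).

Lemma total_recourse_clock tau :
  total_recourse timeline X (clock tau) = \sum_j job_recourse j tau.
Proof.
rewrite /total_recourse /step_recourse (eq_bigr _ (fun t _ => big_mkcond _ _)).
by rewrite exchange_big; apply: eq_bigr => j _; rewrite -big_mkcond.
Qed.

Lemma job_recourse_ge0 j tau : 0 <= job_recourse j tau.
Proof. by apply: sumr_ge0 => t _; rewrite divr_ge0 ?sumr_ge0. Qed.

Let job_recourseE j tau : job_recourse j tau = \sum_(0 <= t < clock tau)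
  (if active timeline t j && active timeline t.+1 j
   then (\sum_(i < m) `|X t.+1 j i - X t j i|) / 2 else 0).
Proof. by rewrite big_mkord -big_mkcond. Qed.

Lemma job_recourse_mono j tau tau' : (tau <= tau')%N ->
  job_recourse j tau <= job_recourse j tau'.
Proof.
move=> /clock_mono le_tau; rewrite !job_recourseE.
rewrite (big_cat_nat (leq0n _) le_tau) //= lerDl sumr_ge0 // => t _.
by case: ifP => // _; rewrite divr_ge0 ?sumr_ge0.
Qed.

(* The coordinates of the difference of two fraction vectors add up to 0, so
   each of them is at most half of the L1 norm. *)
Lemma norm_le_half_sum (v : 'I_m -> R) i :
  \sum_i0 v i0 = 0 -> `|v i| <= (\sum_i0 `|v i0|) / 2.
Proof.
rewrite (bigD1 i) //= [X in _ <= X / 2](bigD1 i) //=.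
move/eqP; rewrite addr_eq0 => /eqP v_i.
have : `|v i| <= \sum_(i0 | i0 != i) `|v i0|.
  by rewrite {1}v_i normrN ler_norm_sum.
lra.
Qed.

(** The job stays active from [clock tau] to [clock tau'], so no step in between is left out of its
    recourse; telescope, and bound each step by half its L1 norm. *)
Lemma dist_job_recourse j i tau tau' : (s j <= tau)%N -> (tau <= tau')%N ->
  (tau' < e j)%N ->
  `|X (clock tau') j i - X (clock tau) j i|
     <= job_recourse j tau' - job_recourse j tau.
Proof.
move=> le_s le_tau lt_e; have le_clock := clock_mono le_tau.
rewrite -(telescope_sumr (fun t => X t j i) le_clock) !job_recourseE.
rewrite (big_cat_nat (leq0n _) le_clock) //= addrAC subrr add0r.
have act t : (clock tau <= t <= clock tau')%N -> active timeline t j.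
  case/andP => le_t ge_t; apply/andP; split.
    have : (true, j) \in take (clock tau) timeline.
      by rewrite mem_take_clock /event_key /=; lia.
    by rewrite -(take_takel _ le_t) => /mem_take.
  have : (false, j) \notin take (clock tau') timeline.
    by rewrite mem_take_clock /event_key /=; lia.
  by apply: contra; rewrite -(take_takel _ ge_t) => /mem_take.
apply: le_trans (ler_norm_sum _ _ _) _; apply: ler_sum_nat => t.
case/andP => le_t lt_t; rewrite !act; try lia; rewrite /=.
apply: norm_le_half_sum (fun i => X t.+1 j i - X t j i) _ _.
have sum1 u : (clock tau <= u <= clock tau')%N -> \sum_i0 X u j i0 = 1.
  move=> u_in; have le_u : (u <= size timeline)%N.
    by have := clock_le_size tau'; lia.
  by case: (schedX le_u (act u u_in)).
by rewrite sumrB !sum1 ?subrr //; lia.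
Qed.
End Recourse.
End Timeline.

(** * Digits, parities and the hierarchy of jobs *)

Lemma big_ord_mul (V : Type) (idx : V) (op : Monoid.law idx) (a b : nat)
    (F : nat -> V) :
  \big[op/idx]_(t < a * b) F t =
  \big[op/idx]_(i < a) \big[op/idx]_(j < b) F (i * b + j)%N.
Proof.
rewrite -(big_mkord xpredT F) big_nat_mul big_mkord; apply: eq_bigr => i _.
rewrite -[(i * b)%N]add0n big_addn mulSn addnK big_mkord.
by apply: eq_bigr => j _; rewrite add0n addnC.
Qed.

Section Hierarchy.
Variables (r h' : nat).
Hypothesis r_gt0 : (0 < r)%N.
Let h := h'.+1.
Let B := r.*2.
Let machine := {ffun 'I_h -> bool}.

Let B_gt0 : (0 < B)%N. Proof. by rewrite double_gt0. Qed.
Let Bk_gt0 k : (0 < B ^ k)%N. Proof. by rewrite expn_gt0 B_gt0. Qed.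
Let evenB : odd B = false. Proof. exact: odd_double. Qed.

Definition digit_parity (tau i : nat) : bool := odd (tau %/ B ^ i).

Definition parity_machine (tau : nat) : machine :=
  [ffun i : 'I_h => digit_parity tau i].

(* Position i.-1 above k: the number w lists the digits other than the k-th. *)
Definition insert_bit (k w : nat) (b : bool) : machine :=
  [ffun i : 'I_h => if (i < k)%N then digit_parity w i
             else if i == k :> nat then b else digit_parity w i.-1].

Definition low_parities (f : nat -> bool) (k q : nat) : bool :=
  all (fun i => digit_parity q i == f i) (iota 0 k).

Lemma digit_parity_low u q i k : (i < k)%N ->
  digit_parity (u * B ^ k + q) i = digit_parity q i.
Proof.
move=> lt_ik; rewrite /digit_parity -{1}(subnK lt_ik) expnD expnS !mulnA.
by rewrite divnMDl // oddD oddM evenB andbF.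
Qed.

Lemma digit_parity_at u q k : (q < B ^ k)%N ->
  digit_parity (u * B ^ k + q) k = odd u.
Proof. by move=> lt_q; rewrite /digit_parity divnMDl // divn_small ?addn0. Qed.

Lemma digit_parity_high tau k i : (k <= i)%N ->
  digit_parity tau i = digit_parity (tau %/ B ^ k) (i - k).
Proof. by move=> le_k; rewrite /digit_parity -divnMA -expnD subnKC. Qed.

Lemma low_paritiesP f k q :
  reflect (forall i, (i < k)%N -> digit_parity q i = f i) (low_parities f k q).
Proof.
apply: (iffP allP) => [eq_f i lt_i|eq_f i].
  by apply/eqP/eq_f; rewrite mem_iota.
by rewrite mem_iota => /= lt_i; apply/eqP/eq_f.
Qed.

(** Identifies times at which the machine of the time is one of the two machines of the job
    [(k, w)]; the parity of the digit [d] decides which one. *)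
Lemma parity_machine_digit k w d q : (k <= h')%N -> (d < B)%N -> (q < B ^ k)%N ->
  low_parities (digit_parity w) k q ->
  parity_machine (w %/ B ^ k * B ^ k.+1 + (d * B ^ k + q)) =
  insert_bit k w (odd d).
Proof.
move=> le_k lt_d lt_q /low_paritiesP eq_q; apply/ffunP => i; rewrite !ffunE.
have lt_dq : (d * B ^ k + q < B ^ k.+1)%N.
  by rewrite expnS; nia.
case: ltngtP => [lt_ik|lt_ki|->].
- by rewrite digit_parity_low ?digit_parity_low ?eq_q //; lia.
- rewrite (digit_parity_high _ lt_ki) divnMDl // (divn_small lt_dq) addn0.
  rewrite [RHS](@digit_parity_high _ k); last by lia.
  by congr digit_parity; lia.
- by rewrite expnS mulnA addnA -mulnDl digit_parity_at // oddD oddM evenB andbF.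
Qed.

(** Each digit has [r] of its [B] values with the prescribed parity. This count is what the job size
    [r^-k] compensates. *)
Lemma card_low_parities f k : (\sum_(q < B ^ k) low_parities f k q = r ^ k)%N.
Proof.
elim: k => [|k IHk]; first by rewrite big_ord1.
rewrite expnS (big_ord_mul _ B (B ^ k) (fun q => low_parities f k.+1 q : nat)).
transitivity (\sum_(d < B) (odd d == f k) * r ^ k)%N.
  apply: eq_bigr => d _; rewrite -IHk big_distrr /=; apply: eq_bigr => q _.
  rewrite /low_parities -addn1 iotaD all_cat /= andbT digit_parity_at //.
  rewrite mulnb andbC; congr (nat_of_bool (_ && _)); apply: eq_in_all => i.
  by rewrite mem_iota => /= lt_i; rewrite digit_parity_low.
rewrite -big_distrl /= expnS; congr (_ * _)%N.
rewrite /B -muln2 (big_ord_mul _ r 2 (fun d => (odd d == f k) : nat)).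
rewrite (eq_bigr (fun=> 1%N)) ?sum_nat_const ?card_ord ?muln1 // => i _.
by rewrite !big_ord_recl big_ord0 /= !oddD !oddM andbF /=; case: (f k).
Qed.

Lemma big_ord_block (V : nmodType) (F : nat -> V) (k : nat) :
  \sum_(v < B ^ k.+1) F v =
  \sum_(i < r) \sum_(b < 2) \sum_(q < B ^ k) F ((i * 2 + b) * B ^ k + q)%N.
Proof.
rewrite expnS big_ord_mul /B -muln2.
by rewrite (big_ord_mul _ r 2 (fun d => \sum_(q < _) F (d * _ + q)%N)).
Qed.

(** The digits of [j.2] from position [j.1] up name a subtree of height [j.1.+1], whose leaves form
    the lifetime; the lower digits affect only the machines. *)
Definition arrival (j : 'I_h * 'I_(B ^ h')) : nat :=
  (j.2 %/ B ^ j.1 * B ^ j.1.+1)%N.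

Definition departure (j : 'I_h * 'I_(B ^ h')) : nat :=
  (arrival j + B ^ j.1.+1)%N.

Lemma departure_le j : (departure j <= B ^ h)%N.
Proof.
case: j => k w; rewrite /departure /arrival /= -mulSnr.
have le_k : (k <= h')%N by rewrite -ltnS.
have -> : (B ^ h = B ^ (h' - k) * B ^ k.+1)%N by rewrite -expnD addnS subnK.
by rewrite leq_mul2r ltn_divLR // -expnD subnK // ltn_ord orbT.
Qed.

Lemma aliveE j tau :
  (arrival j <= tau < departure j)%N = (tau %/ B ^ j.1.+1 == j.2 %/ B ^ j.1)%N.
Proof.
by rewrite /departure /arrival -mulSnr -leq_divRL // -ltn_divLR // ltnS -eqn_leq eq_sym.
Qed.

(** * Averaging the load over time *)

Section Averaging.
Variables (R : realType) (x : nat -> 'I_h * 'I_(B ^ h') -> machine -> R).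
Variable G : 'I_h * 'I_(B ^ h') -> nat -> R.
Hypothesis x_ge0 : forall tau j mu, (arrival j <= tau < departure j)%N ->
  0 <= x tau j mu.
Hypothesis x_sum1 : forall tau j, (arrival j <= tau < departure j)%N ->
  x tau j (insert_bit j.1 j.2 false) + x tau j (insert_bit j.1 j.2 true) = 1.
Hypothesis G0_ge0 : forall j, 0 <= G j 0.
Hypothesis G_mono : forall j tau tau', (tau <= tau')%N -> G j tau <= G j tau'.
Hypothesis dist_G : forall j mu tau tau', (arrival j <= tau)%N ->
  (tau <= tau')%N -> (tau' < departure j)%N ->
  `|x tau' j mu - x tau j mu| <= G j tau' - G j tau.

(** Under children [2i] and [2i + 1], times with equal tails of the right parities watch the two
    different machines of the job. Its fractions there add up to at least 1 minus its recourse
    during the pair. The [r] pairs occupy disjoint intervals, so these recourses telescope to at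
    most [G j (B ^ h)]. *)
Lemma job_average (j : 'I_h * 'I_(B ^ h')) :
  r%:R - G j (B ^ h)%N <= (r ^ j.1)%:R^-1 *
    \sum_(tau < B ^ h | (arrival j <= tau < departure j)%N)
       x tau j (parity_machine tau).
Proof.
rewrite mulrC ler_pdivlMr ?ltr0n ?expn_gt0 ?r_gt0 //.
pose F tau := if (arrival j <= tau < departure j)%N
              then x tau j (parity_machine tau) else 0.
have F_ge0 tau : 0 <= F tau by rewrite /F; case: ifP => // /x_ge0.
rewrite big_mkcond -(big_mkord xpredT F).
have le_k : (j.1 <= h')%N by rewrite -ltnS.
have eqBh : (B ^ h = B ^ (h' - j.1) * B ^ j.1.+1)%N.
  by rewrite -expnD addnS subnK.
have lt_u : (j.2 %/ B ^ j.1 < B ^ (h' - j.1))%N.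
  by rewrite ltn_divLR // -expnD subnK.
rewrite {2}eqBh big_mkord big_ord_mul (bigD1 (Ordinal lt_u)) //=.
apply: ler_wpDr; first by do 2! [apply: sumr_ge0 => ? _].
rewrite (big_ord_block (fun v => F (_ + v)%N)).
(* Start of the [i]-th pair of children. *)
pose st i := (arrival j + (i * 2) * B ^ j.1)%N.
have -> : r%:R - G j (B ^ h)%N = \sum_(i < r) 1 - G j (B ^ h)%N.
  by rewrite sumr_const card_ord.
have le_st : (st r <= B ^ h)%N.
  rewrite /st muln2 -expnS; exact: departure_le.
have le_tel : \sum_(i < r) (G j (st i.+1) - G j (st i)) <= G j (B ^ h)%N.
  rewrite -(big_mkord xpredT (fun i => G j (st i.+1) - G j (st i))).
  rewrite (telescope_sumr (fun i => G j (st i))) //.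
  have := le_trans (G0_ge0 j) (G_mono j (leq0n (st 0))).
  by have := G_mono j le_st; lra.
apply: (@le_trans _ _ ((\sum_(i < r) (1 - (G j (st i.+1) - G j (st i)))) * (r ^ j.1)%:R)).
  rewrite ler_wpM2r // sumrB; lra.
rewrite mulr_suml; apply: ler_sum => i _.
rewrite !big_ord_recl big_ord0 addr0 /= -big_split /=.
rewrite -(card_low_parities (digit_parity j.2) j.1) natr_sum mulr_sumr.
apply: ler_sum => q _; rewrite /bump /= addn0.
(* Tails with other parities contribute nonnegative terms, which are dropped; the [r ^ j.1]
   remaining ones each contribute the same bound. *)
case low_q : (low_parities _ _ _); last by rewrite mulr0 addr_ge0.
have lt_d b : (b < 2)%N -> (i * 2 + b < B)%N by have := ltn_ord i; rewrite /B; lia.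
have lt_dq b : (b < 2)%N -> ((i * 2 + b) * B ^ j.1 + q < B ^ j.1.+1)%N.
  by move=> /lt_d; rewrite expnS; have := ltn_ord q; nia.
have alive b : (b < 2)%N -> (arrival j <= arrival j + ((i * 2 + b) * B ^ j.1 + q)
     < departure j)%N.
  by move=> /lt_dq lt_b; rewrite leq_addr /departure ltn_add2l.
have parE b : (b < 2)%N -> F (arrival j + ((i * 2 + b) * B ^ j.1 + q))%N =
    x (arrival j + ((i * 2 + b) * B ^ j.1 + q)) j (insert_bit j.1 j.2 (odd b)).
  move=> lt_b; rewrite /F alive // /arrival parity_machine_digit ?lt_d //.
  by rewrite oddD oddM andbF.
move: (parE 0%N isT) (parE 1%N isT); rewrite /arrival addn0 => -> ->.
rewrite -/(arrival j) mulr1.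
have := alive 0%N isT; have := alive 1%N isT; rewrite addn0.
set t0 := (arrival j + (i * 2 * B ^ j.1 + q))%N.
set t1 := (arrival j + ((i * 2 + 1) * B ^ j.1 + q))%N => alive1 alive0.
have le01 : (t0 <= t1)%N by rewrite /t0 /t1; nia.
have := @dist_G j (insert_bit j.1 j.2 false) t0 t1.
case/andP: (alive0) => -> _; case/andP: (alive1) => _ -> /(_ isT le01 isT).
have := x_sum1 alive1.
have := G_mono j (_ : st i <= t0)%N; rewrite {1}/st /t0 addnA leq_addr => /(_ isT).
have : (t1 <= st i.+1)%N by rewrite /st /t1; have := ltn_ord q; nia.
move=> /(G_mono j).
by rewrite ler_norml => ? ? ? /andP[? ?]; rewrite /=; lra.
Qed.

(** Sum [job_average] over the [h * B ^ h'] jobs and exchange the sums: each of the [B ^ h] times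
    contributes at most [a]. *)
Lemma recourse_lower_bound (a : R) :
  (forall tau, (tau < B ^ h)%N ->
    \sum_(j | (arrival j <= tau < departure j)%N)
      (r ^ j.1)%:R^-1 * x tau j (parity_machine tau) <= a) ->
  (h * B ^ h')%:R * r%:R - (B ^ h)%:R * a <= \sum_j G j (B ^ h)%N.
Proof.
move=> load_le.
have avg : \sum_j (r%:R - G j (B ^ h)%N) <= (B ^ h)%:R * a.
  apply: le_trans (ler_sum _ (fun j _ => job_average j)) _.
  under eq_bigr => j _ do rewrite mulr_sumr big_mkcond /=.
  rewrite exchange_big /=.
  have -> : (B ^ h)%:R * a = \sum_(tau < B ^ h) a.
    by rewrite sumr_const card_ord mulr_natl.
  by apply: ler_sum => tau _; rewrite -big_mkcond load_le.
move: avg; rewrite sumrB sumr_const card_prod !card_ord.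
rewrite -[r%:R *+ _]mulr_natl; lra.
Qed.
End Averaging.

(** * A schedule of makespan 1 for the hierarchy *)

(** A level-[k] job placed on [mu] forces [mu] to differ from the parities of [tau] at [k] and to
    agree above, so a single level loads [mu]. There the high digits of [w] are fixed by [tau] and
    the low parities by [mu], leaving at most [r ^ k] jobs of size [r^-k]. *)
Lemma schedule_load (R : realType) (tau : nat) (mu : machine) :
  \sum_(j : 'I_h * 'I_(B ^ h') | (arrival j <= tau < departure j)%N &&
      (insert_bit j.1 j.2 (~~ digit_parity tau j.1) == mu)) (r ^ j.1)%:R^-1 <= 1 :> R.
Proof.
pose top (k : 'I_h) := (mu k != digit_parity tau k) &&
  [forall i : 'I_h, (k < i)%N ==> (mu i == digit_parity tau i)].
have top_inj k k' : top k -> top k' -> k = k'.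
  case/andP=> k1 /forallP k2 /andP[k1' /forallP k2']; apply: val_inj => /=.
  by have := k2 k'; have := k2' k; rewrite (negPf k1) (negPf k1'); case: ltngtP.
have top_of (j : 'I_h * 'I_(B ^ h')) : (arrival j <= tau < departure j)%N ->
    insert_bit j.1 j.2 (~~ digit_parity tau j.1) = mu ->
    top j.1 /\ low_parities (fun i => mu (inord i)) j.1 (j.2 %% B ^ j.1).
  case: j => k w; rewrite aliveE /= => /eqP eq_u eq_mu; rewrite /top -!eq_mu; split.
    rewrite ffunE ltnn eqxx; apply/andP; split; first by case: digit_parity.
    apply/forallP => i; apply/implyP => lt_ki; rewrite ffunE ltnNge ltnW //=.
    rewrite gtn_eqF // (digit_parity_high _ lt_ki) eq_u.
    rewrite (@digit_parity_high _ k); last by lia.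
    by apply/eqP; congr digit_parity; lia.
  apply/low_paritiesP => i lt_i; rewrite ffunE inordK; last first.
    by apply: ltn_trans lt_i _.
  by rewrite lt_i [in RHS](divn_eq w (B ^ k)) digit_parity_low.
case: (boolP [exists k, top k]) => [/existsP[k0 top_k0]|/existsPn no_top]; last first.
  rewrite big1 ?ler01 // => j /andP[alive /eqP /(top_of _ alive)[top_j _]].
  by have := no_top j.1; rewrite top_j.
have k0_le : (k0 <= h')%N by rewrite -ltnS.
pose P (w : nat) := (w %/ B ^ k0 == tau %/ B ^ k0.+1)%N &&
    low_parities (fun i => mu (inord i)) k0 (w %% B ^ k0).
apply: (@le_trans _ _ (\sum_(w < B ^ h') (P w)%:R * (r ^ k0)%:R^-1)).
  rewrite -(pair_big_dep xpredT (fun k w => (arrival (k, w) <= tau < departure (k, w))%N &&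
    (insert_bit k w (~~ digit_parity tau k) == mu)) (fun k _ => (r ^ k)%:R^-1)) /=.
  rewrite (bigD1 k0) //= [X in _ + X]big1 ?addr0 => [|k ne_k]; last first.
    apply: big1 => w /andP[alive /eqP /(top_of _ alive)[top_k _]].
    by move: ne_k; rewrite -(top_inj _ _ top_k top_k0) eqxx.
  rewrite big_mkcond /=; apply: ler_sum => w _; case: ifP => [|_]; last first.
    by rewrite mulr_ge0 ?ler0n ?invr_ge0.
  case/andP => alive /eqP /(top_of _ alive)[_ low_w].
  by move: alive; rewrite aliveE /P low_w andbT eq_sym => /= ->; rewrite mul1r.
rewrite -mulr_suml -natr_sum ler_pdivrMr ?ltr0n ?expn_gt0 ?r_gt0 // mul1r ler_nat.
have -> : (B ^ h' = B ^ (h' - k0) * B ^ k0)%N by rewrite -expnD subnK.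
rewrite (big_ord_mul _ _ _ (fun w => P w : nat)).
have inner u : (\sum_(q < B ^ k0) P (u * B ^ k0 + q)%N = (u == tau %/ B ^ k0.+1) * r ^ k0)%N.
  rewrite -(card_low_parities (fun i => mu (inord i)) k0) big_distrr /=.
  apply: eq_bigr => q _; rewrite /P divnMDl // divn_small // addn0.
  by rewrite modnMDl modn_small // mulnb.
under eq_bigr => u _ do rewrite inner.
rewrite -big_distrl /= -[leqRHS]mul1n leq_mul2r; apply/orP; right.
(* Times past the last leaf lie in no subtree, so no job is counted for them. *)
case: (ltnP (tau %/ B ^ k0.+1) (B ^ (h' - k0))) => [lt_u|ge_u].
  rewrite (bigD1 (Ordinal lt_u)) //= eqxx big1 // => u ne_u.
  by rewrite -val_eqE /= in ne_u; rewrite (negPf ne_u).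
by rewrite big1 // => u _; have := ltn_ord u; case: eqP => // ->; lia.
Qed.
End Hierarchy.

(** * The full instance, with padding jobs *)

Section Instance.
Variables (R : realType) (r h' d : nat).
Hypothesis r_gt0 : (0 < r)%N.
Let h := h'.+1.
Let B := r.*2.
Let machine := {ffun 'I_h -> bool}.
Let job : finType := (('I_h * 'I_(B ^ h')) + 'I_d)%type.

(** Padding begins at [B ^ h + 1], after the last possible departure of a hierarchy job, and each
    padding job lives for one time unit. *)
Let start (j : 'I_#|job|) : nat :=
  match enum_val j with
  | inl j0 => arrival j0
  | inr i => (B ^ h + i).+1
  end.

Let stop (j : 'I_#|job|) : nat :=
  match enum_val j with
  | inl j0 => departure j0
  | inr i => (B ^ h + i).+2
  end.

Let size_of (j : 'I_#|job|) : R :=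
  if enum_val j is inl j0 then (r ^ j0.1)%:R^-1 else 1.

Let allowed (j : 'I_#|job|) : {set 'I_#|machine|} :=
  if enum_val j is inl j0
  then [set i | [exists b, enum_val i == insert_bit r h' j0.1 j0.2 b :> machine]]
  else setT.

Let lt_start_stop j : (start j < stop j)%N.
Proof.
rewrite /start /stop; case: (enum_val j) => [j0|i] //.
by rewrite /departure -[ltnLHS]addn0 ltn_add2l expn_gt0 double_gt0 r_gt0.
Qed.

Let size_gt0 j : 0 < size_of j.
Proof.
rewrite /size_of; case: (enum_val j) => [j0|//].
by rewrite invr_gt0 ltr0n expn_gt0 r_gt0.
Qed.

Let sum_job (P : pred job) (F : job -> R) :
  \sum_(j < #|job| | P (enum_val j)) F (enum_val j) =
  \sum_(j0 | P (inl j0)) F (inl j0) + \sum_(i | P (inr i)) F (inr i).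
Proof.
rewrite -big_sumType (reindex enum_rank) /=; last exact/onW_bij/enum_rank_bij.
by apply: eq_big => [u|u _]; rewrite enum_rankK.
Qed.

Let feasible : feasible_instance size_of allowed (timeline start stop) 1.
Proof.
move=> t _; have [tau act] := active_timeline lt_start_stop t.
pose sigma (j : 'I_#|job|) : 'I_#|machine| :=
  if enum_val j is inl j0
  then enum_rank (insert_bit r h' j0.1 j0.2 (~~ digit_parity r tau j0.1))
  else enum_rank (parity_machine r h' 0).
exists sigma; split=> [j _|mu].
  rewrite /sigma /allowed; case: (enum_val j) => [j0|i]; last exact: in_setT.
  by rewrite inE; apply/existsP; eexists; rewrite enum_rankK.
pose alive (j : job) := match j with
  | inl j0 => (arrival j0 <= tau < departure j0)%N &&
      (insert_bit r h' j0.1 j0.2 (~~ digit_parity r tau j0.1) == enum_val mu)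
  | inr i => (B ^ h + i).+1 == tau
  end.
pose szJ (j : job) : R := if j is inl j0 then (r ^ j0.1)%:R^-1 else 1.
apply: (@le_trans _ _ (\sum_(j < #|job| | alive (enum_val j)) szJ (enum_val j))).
  rewrite big_mkcond [leRHS]big_mkcond; apply: ler_sum => j _.
  case: ifP => [/andP[/act]|_]; last by case: ifP => // _; exact/ltW/size_gt0.
  rewrite /start /stop /sigma /szJ /size_of /alive.
  case: (enum_val j) => [j0 -> /eqP <-|i in_i _]; first by rewrite enum_rankK eqxx.
  by rewrite ifT //; apply/eqP; lia.
rewrite sum_job /=; have [lt_tau|ge_tau] := ltnP (B ^ h) tau.
  rewrite big1 ?add0r => [|j0 /andP[/andP[_ lt_tau'] _]]; last first.
    by have := departure_le r_gt0 j0; rewrite -/B -/h; lia.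
  rewrite (eq_bigl (fun i : 'I_d => i == (tau - (B ^ h).+1)%N :> nat)); last first.
    by move=> i; apply/eqP/eqP; lia.
  rewrite sumr_const -[leRHS]/(1%:R) ler_nat; apply/card_le1_eqP => i i'.
  by rewrite !unfold_in => /eqP eq_i /eqP eq_i'; apply: val_inj; rewrite /= eq_i.
rewrite [X in _ + X]big1 ?addr0 => [|i /eqP]; last by lia.
exact: schedule_load.
Qed.

Lemma hierarchy_instance :
  exists (m : nat) (p : 'I_#|job| -> R) (allowed : 'I_#|job| -> {set 'I_m})
         (ev : seq (event #|job|)),
    [/\ forall j, 0 < p j, valid_events ev & feasible_instance p allowed ev 1] /\
    forall (a : R) (X : nat -> 'I_#|job| -> 'I_m -> R),
      (forall t, (t <= size ev)%N ->
         frac_schedule allowed ev t (X t) /\ forall i, load p ev t (X t) i <= a) ->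
      exists t : nat, [/\ (0 < t)%N, (t <= size ev)%N,
        (t <= 2 * (h * B ^ h'))%N &
        (h * B ^ h')%:R * r%:R - (B ^ h)%:R * a <= total_recourse ev X t].
Proof.
exists #|machine|, size_of, allowed, (timeline start stop); split.
  by split=> //; exact: timeline_valid.
move=> a X schedX; pose ck := clock start stop.
have sched tau := schedX _ (clock_le_size start stop tau).
have fracX t (le_t : (t <= size (timeline start stop))%N) := (schedX t le_t).1.
(* Here all hierarchy jobs have departed and no padding job has arrived. *)
exists (ck (B ^ h)%N); split.
- have lt0 : (0 < B ^ h')%N by rewrite expn_gt0 double_gt0 r_gt0.
  apply: (@clock_gt0 _ _ _ _ (enum_rank (inl (ord0, Ordinal lt0) : job))).
  by rewrite /start enum_rankK /arrival /= div0n.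
- exact: clock_le_size.
- apply: leq_trans (clock_le_card lt_start_stop _) _; rewrite leq_mul2l /=.
  rewrite -sum1_card (reindex (@enum_rank job)) /=; last exact/onW_bij/enum_rank_bij.
  rewrite big_sumType /= [X in (_ + X)%N]big_pred0 ?addn0 => [|i]; last first.
    by rewrite unfold_in /= /start enum_rankK; lia.
  apply: (@leq_trans (\sum_(j0 : 'I_h * 'I_(B ^ h')) 1)%N).
    by rewrite big_mkcond leq_sum // => j0 _; case: ifP.
  by rewrite sum1_card card_prod !card_ord.
rewrite total_recourse_clock.
pose emb (j0 : 'I_h * 'I_(B ^ h')) : 'I_#|job| := enum_rank (inl j0 : job).
pose x tau j0 (mu : machine) := X (ck tau) (emb j0) (enum_rank mu).
pose G j0 tau := job_recourse start stop X (emb j0) tau.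
have alive tau j0 : (arrival j0 <= tau < departure j0)%N ->
    active (timeline start stop) (ck tau) (emb j0).
  by rewrite active_clock /start /stop enum_rankK.
apply: (@le_trans _ _ (\sum_j0 G j0 (B ^ h)%N)); last first.
  rewrite (reindex (@enum_rank job)) /=; last exact/onW_bij/enum_rank_bij.
  rewrite big_sumType /= lerDl sumr_ge0 // => i _.
  exact: job_recourse_ge0.
apply: (@recourse_lower_bound r h' r_gt0 R x G).
- move=> tau j0 mu /alive act; have [x_ge0 _ _] := (sched tau).1 _ act.
  exact: x_ge0.
- move=> tau j0 /alive act; have [_ x0 <-] := (sched tau).1 _ act.
  rewrite (reindex (@enum_rank machine)) /=; last exact/onW_bij/enum_rank_bij.
  rewrite (bigD1 (insert_bit r h' j0.1 j0.2 false)) //=.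
  rewrite (bigD1 (insert_bit r h' j0.1 j0.2 true)) /=; last first.
    by apply/eqP => /ffunP/(_ j0.1); rewrite !ffunE ltnn eqxx.
  rewrite big1 ?addr0 // => mu /andP[neq_f neq_t]; apply: x0.
  rewrite /allowed /emb enum_rankK inE; apply/existsPn => b; rewrite enum_rankK.
  by case: b.
- by move=> j0; exact: job_recourse_ge0.
- by move=> j0 tau tau'; exact: job_recourse_mono.
- move=> j0 mu tau tau' le_arr le_tau lt_dep.
  apply: (dist_job_recourse fracX) => //.
    by rewrite /start /emb enum_rankK.
  by rewrite /stop /emb enum_rankK.
move=> tau lt_tau; apply: le_trans ((sched tau).2 (enum_rank (parity_machine r h' tau))).
rewrite /load (reindex (@enum_rank job)) /=; last exact/onW_bij/enum_rank_bij.
rewrite big_sumType /= ler_wpDr ?sumr_ge0 //.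
  move=> i act; have [x_ge0 _ _] := (sched tau).1 _ act.
  by rewrite mulr_ge0 ?x_ge0 // ltW ?size_gt0.
rewrite le_eqVlt; apply/orP; left; apply/eqP; apply: eq_big => j0.
  by rewrite active_clock /start /stop enum_rankK.
by move=> _; rewrite /size_of enum_rankK.
Qed.
End Instance.

(** * Choice of the parameters *)

(** Take the largest [r] with [(4 * r) ^ h <= n]; then [n] is below [(4 * r.+1) ^ h], and
    [r.+1 <= 2 * r]. The value 128 qualifies since [512 = 4 * 128]. *)
Lemma radix_exists (h n : nat) : (0 < h)%N -> (512 ^ h <= n)%N ->
  exists r, [/\ (128 <= r)%N, ((4 * r) ^ h <= n)%N & (n <= (8 * r) ^ h)%N].
Proof.
move=> h_gt0 le_n; pose P r := ((4 * r) ^ h <= n)%N.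
have P128 : P 128%N by [].
have P_le r : P r -> (r <= n)%N.
  apply: leq_trans; case: h h_gt0 {le_n P P128} => // h _.
  case: r => // r; rewrite expnS.
  by have : (0 < (4 * r.+1) ^ h)%N; [rewrite expn_gt0 | nia].
have exP : exists r, P r by exists 128%N.
case: (ex_maxnP exP P_le) => r Pr max_r.
have le_r := max_r _ P128; exists r; split=> //.
have : ~~ P r.+1 by apply/negP => /max_r; rewrite ltnn.
rewrite /P -ltnNge => /ltnW/leq_trans; apply.
by rewrite leq_exp2r //; lia.
Qed.

(** The root is at most [sqrt (8 * r)], and [8 * r <= (r / 4)^2] holds exactly from [r = 128] on. *)
Lemma powR_half_root (R : realType) (h n r : nat) :
  (0 < h)%N -> (128 <= r)%N -> (n <= (8 * r) ^ h)%N ->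
  n%:R `^ ((2 * h%:R)^-1) <= r%:R / 4 :> R.
Proof.
move=> h_gt0 le_r le_n.
have h_neq0 : h%:R != 0 :> R by rewrite pnatr_eq0 -lt0n.
apply: (@le_trans _ _ (((8 * r) ^ h)%:R `^ ((2 * h%:R)^-1))).
  by rewrite ge0_ler_powR ?nnegrE ?ler0n ?ler_nat // invr_ge0 mulr_ge0.
rewrite natrX -powR_mulrn ?ler0n // -powRrM invfM mulrCA divff // mulr1.
have r4_ge0 : 0 <= r%:R / 4 :> R by rewrite divr_ge0.
rewrite powR12_sqrt ?ler0n // -(ger0_norm r4_ge0) -sqrtr_sqr ler_wsqrtr //.
have : 128 <= r%:R :> R by rewrite (ler_nat R 128).
by rewrite natrM expr2; nra.
Qed.

Theorem theorem9 (R : realType) (alpha : nat -> R)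
  (alpha_pos : forall k, 0 < alpha k)
  (alpha_mono : forall k l, (k <= l)%N -> alpha k <= alpha l)
  (alpha_little_o_log : forall eps : R, 0 < eps ->
     exists N : nat, forall k, (N <= k)%N -> alpha k <= eps * ln (k%:R)) :
  exists c : R, 0 < c /\
  forall N : nat, exists n : nat, (N <= n)%N /\
  exists (m : nat) (p : 'I_n -> R) (allowed : 'I_n -> {set 'I_m})
         (ev : seq (event n)) (Tstar : R),
    [/\ forall j, 0 < p j, 0 < Tstar, valid_events ev &
        feasible_instance p allowed ev Tstar] /\
    forall X : nat -> 'I_n -> 'I_m -> R,
      (forall t, (t <= size ev)%N ->
         frac_schedule allowed ev t (X t) /\
         forall i, load p ev t (X t) i <= alpha n * Tstar) ->
      exists t : nat, [/\ (0 < t)%N, (t <= size ev)%N &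
        (n%:R `^ (c / alpha n)) * t%:R <= total_recourse ev X t].
Proof.
(* Monotonicity gives [1 <= a / alpha 0], so [h <= 4 * a + 1 <= C * a]. The condition [512 ^ h <= n]
   then follows from [C * a * L <= ln n], which fixes the epsilon [(C * L)^-1]. *)
pose C : R := 4 + (alpha 0%N)^-1; pose L : R := ln 512%:R.
have a0_gt0 := alpha_pos 0%N.
have C_gt0 : 0 < C by rewrite addr_gt0 ?invr_gt0.
have L_gt0 : 0 < L by rewrite ln_gt0 ?ltr1n.
have eps_gt0 : 0 < (C * L)^-1 by rewrite invr_gt0 mulr_gt0.
(* With [h <= C * a], the exponent [c / a] is at most [1 / (2 * h)]. *)
exists (2 * C)^-1; split; first by rewrite invr_gt0 mulr_gt0.
move=> N; have [N0 alpha_le] := alpha_little_o_log _ eps_gt0.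
pose n := (maxn N N0).+1; pose a := alpha n.
have a_gt0 : 0 < a := alpha_pos n.
pose h' := Num.truncn (4 * a); pose h := h'.+1.
have lt_h : 4 * a < h%:R by exact: truncnS_gt.
have le_h : h%:R <= C * a.
  have : h'%:R <= 4 * a by rewrite /h' truncn_le ?mulr_ge0 ?ltW.
  have : 1 <= (alpha 0%N)^-1 * a by rewrite mulrC ler_pdivlMr ?mul1r ?alpha_mono.
  by rewrite /C /h -natr1 mulrDl; lra.
have le_n : (512 ^ h <= n)%N.
  rewrite -(ler_nat R) natrX -ler_ln ?posrE ?exprn_gt0 ?ltr0n // lnXn ?ltr0n //.
  rewrite -[_ *+ h]mulr_natl; apply: (@le_trans _ _ (C * a * L)).
    by rewrite ler_wpM2r // ltW.
  have : a <= (C * L)^-1 * ln n%:R by apply: alpha_le; rewrite /n; lia.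
  by rewrite mulrC ler_pdivlMr ?mulr_gt0 // mulrA [a * C]mulrC.
have [r [r_ge le_rn le_nr]] := radix_exists (ltn0Sn h') le_n.
have r_gt0 : (0 < r)%N by lia.
(* The hierarchy jobs fit into [n] because [h <= 2 ^ h] and [4 * r = 2 * B]; the other [d] jobs are
   padding. *)
have le_real : (h * r.*2 ^ h' <= n)%N.
  apply: leq_trans le_rn; rewrite (_ : 4 * r = 2 * r.*2)%N; last by lia.
  rewrite expnMn leq_mul //; first exact/ltnW/ltn_expl.
  by rewrite leq_exp2l //; lia.
pose d := (n - h * r.*2 ^ h')%N.
pose job : finType := (('I_h * 'I_(r.*2 ^ h')) + 'I_d)%type.
have card_job : #|job| = n.
  by rewrite card_sum card_prod !card_ord subnKC.
exists n; split; first by rewrite /n; lia.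
have := hierarchy_instance R h' d r_gt0; rewrite -/h -/job card_job.
move=> [m [p [allowed [ev [[p_gt0 valid feas] lower]]]]].
exists m, p, allowed, ev, 1; split=> // X schedX.
have [t [t_gt0 t_size le_t le_rec]] := lower (alpha n * 1) X schedX.
exists t; split=> //; apply: le_trans le_rec.
apply: (@le_trans _ _ (r%:R / 4 * t%:R)).
  rewrite ler_wpM2r ?ler0n //; apply: le_trans (powR_half_root R (ltn0Sn h') r_ge le_nr).
  rewrite ler_powR ?ler1n // -invfM lef_pV2 ?posrE ?mulr_gt0 ?ltr0n //.
  by rewrite -mulrA ler_pM2l.
have {}le_t : t%:R <= 2 * (h%:R * (r.*2 ^ h')%:R) :> R.
  by rewrite -!natrM ler_nat.
apply: (@le_trans _ _ (r%:R / 4 * (2 * (h%:R * (r.*2 ^ h')%:R)))).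
  by rewrite ler_wpM2l // divr_ge0.
(* Since [4 * a < h], the subtracted term [2 * r * W * a] is at most half of [h * W * r]; the
   remaining half equals the left side. *)
rewrite expnS !natrM -[r.*2]muln2 !natrM -/a.
set W := (_ ^ h')%:R; have rW_ge0 : 0 <= r%:R * W by rewrite mulr_ge0 ?ler0n.
have := ler_wpM2l rW_ge0 (ltW lt_h); lra.
Qed.
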